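(* Let $f$ be a tamely ramified rational function of degree $d\ge2$ defined over a field $K$ such that $G=G_\infty(K^{\mathrm{sep}},f,t)$ is a martingale group; if $f$ is exceptional, assume furthermore that $K$ has characteristic zero and cardinality at most $2^{\aleph_0}$. Let $N$ be a delay constant for which $G_m$ (defined in the context) is a mixing subgroup of $G$, and let $G_M$ be the maximal mixing subgroup of $G$ with delay constant $N$. If $G_m$ is project invariant, then $G_m=G_M$.
   Context: Trees. $T$ is the rooted tree whose vertices are the finite words over $\{1,\dots,d\}$ (root: empty word; $v$ adjacent to $vx$). $|v|$ is word length and $\mathcal L_n$ the set of words of length $n$. $\mathrm{Aut}(T)$ is the group of rooted tree automorphisms with the congruence topology (pointwise stabilizers of levels form a basis of neighbourhoods of $1$). The section $g|_v$ is defined by $g(vw)=g(v)\,g|_v(w)$. For $G\le \mathrm{Aut}(T)$: $\mathrm{st}_G(v)$ is the stabilizer of $v$, $\mathrm{St}_G(n)=\bigcap_{v\in\mathcal L_n}\mathrm{st}_G(v)$, and for $H\le G$, $H_v=\{h|_v: h\in H,\ h(v)=v\}$. $G$ is self-similar if $g|_v\in G$ for all $g\in G$, $v\in T$; fractal if it is self-similar, transitive on every level, and $G_v=G$ for all $v$. $G$ is a martingale group if for all $n\ge1$ and $v\in\mathcal L_n$, $\mathrm{St}_G(n)$ acts transitively on each level of the subtree $T_v=\{vw\}$. A fractal $G$ is virtually mixing if there are $N\ge0$ (a delay constant) and a finite-index subgroup $H\le G$ (a mixing subgroup) with $H\le \mathrm{St}_G(n)_v$ for all $n\ge1$ and all $v$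 with $|v|\ge n+N$. The maximal mixing subgroup with delay constant $N$ is $G_M=\bigcap_{n\ge1}\bigcap_{v\in\mathcal L_{n+N}}\mathrm{St}_G(n)_v$. A subgroup $H$ of a self-similar group $G$ is project invariant if $H_v\le H$ for all $v\in T$. Galois groups. $\overline K$, $K^{\mathrm{sep}}$ are algebraic and separable closures, $t$ is transcendental over $K$. $e_f(z)$ is the local degree of $f$ at $z\in\mathbb P^1(\overline K)$; $f$ is tamely ramified if $\mathrm{char}\,K$ divides no local degree. $f^n$ is the $n$-th iterate. $T_t=\bigsqcup_{n\ge0}f^{-n}(t)$ is a $d$-regular rooted tree ($w$ in level $n+1$ joined to $f(w)$). $G_\infty(K^{\mathrm{sep}},f,t)$ is the image of $\mathrm{Gal}(K^{\mathrm{sep}}(t)^{\mathrm{sep}}/K^{\mathrm{sep}}(t))$ in $\mathrm{Aut}(T_t)$; it is closed. It is known that some isomorphism of rooted trees $T_t\to T$ makes this group a fractal subgroup of $\mathrm{Aut}(T)$; such an identification is fixed. Orbifolds. $C_f=\{z:e_f(z)>1\}$, $P_f=\bigcup_{n\ge1}f^n(C_f)$; $f$ is post-critically finite if $P_f$ is finite. $\nu_f(z)=\mathrm{lcm}\{e_{f^n}(w): n\ge1, f^n(w)=z\}\in\mathbb N\cup\{\infty\}$. For $f$ post-critically finite, $\chi_f=2-\sum_{z\in P_f}(1-1/\nu_f(z))$; $f$ is exceptional if it is post-critically finite and $\chi_f=0$. Energy. A (backward) path is $\gamma:\{0,\dots,L\}\to\mathbb P^1(\overline K)$ with $f(\gamma(i+1))=\gamma(i)$;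 $\ell(\gamma)=L$, $E(\gamma)=\prod_{i=1}^{L}e_f(\gamma(i))$. For $p\in P_f$, a good pair of $p$ is a pair $(\gamma_1,\gamma_2)$ of paths with $\gamma_1(0)=\gamma_2(0)$, $\gamma_1$ ending at $p$, $\gamma_2$ ending outside $P_f$, and $\ell(\gamma_1)\ge\ell(\gamma_2)$. $\Gamma_{f,p}$ is the set of good pairs of $p$; $\mathcal E(\gamma_1,\gamma_2)=E(\gamma_2)/\gcd(E(\gamma_1),E(\gamma_2))$. $e_p=\gcd\{\mathcal E(P):P\in\Gamma_{f,p}\}$ if $\Gamma_{f,p}\ne\emptyset$ and $e_p=1$ otherwise. Inertia generators. $G_\infty(K^{\mathrm{sep}},f,t)$ is topologically generated by elements $g_p$ ($p\in P_f$), each a topological generator of an inertia subgroup at a prime of the integral closure above $(t-p)$ (the place $t=\infty$ if $p=\infty$), chosen so that for a suitable ordering $\prod_{p\in P_f}g_p=1$. The subgroup $G_m$. Unless $f$ is exceptional with $\nu_f(z)<\infty$ for all $z$, $G_m$ is the normal closure in $G$ of the closed subgroup topologically generated by $\{g_p^{e_p}:p\in P_f\}$. If $f$ is exceptional with $\nu_f(z)<\infty$ for all $z$ (and $K$ is as in the claim), embed $\overline K\subset\mathbb C$; there are a lattice $\Lambda\subset\mathbb C$, a map $F(z)=az+b$ of $\mathbb C/\Lambda$ with $a\Lambda\subseteq\Lambda$, and a finite cyclic group $H=\langle z\mapsto\epsilon z\rangle\le\mathrm{Aut}(\mathbb C/\Lambda)$ with quotient map $\pi:\mathbb C/\Lambda\to\mathbb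 P^1(\mathbb C)$ and $\pi F=f\pi$; then $G\cong\overline{\mathrm{IMG}(f)}$, $\mathrm{IMG}(F)$ embeds in $\mathrm{IMG}(f)$ via $\pi$, and $G_m=\overline{\mathrm{IMG}(F)}$. Here for a finite degree-$d$ (branched) cover $h:X\to X$ with post-critical set $P_h$ and base point $x_0\notin P_h$, $\mathrm{IMG}(h)$ is the image of the monodromy action of $\pi_1(X\setminus P_h,x_0)$ on the tree $\bigsqcup_n h^{-n}(x_0)$, and closures are taken in the automorphism group of the tree. In all cases $G_m$ is a closed normal mixing subgroup of $G$ for some delay constant. *)

(* Defs.v *)
From HB Require Import structures.
From mathcomp Require Import all_boot all_order all_algebra all_field.
From mathcomp Require Import generic_quotient.
From mathcomp Require Import all_classical all_reals all_analysis.
From mathcomp Require Import complex.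

Set Implicit Arguments.
Unset Strict Implicit.
Unset Printing Implicit Defensive.
Import Order.TTheory GRing.Theory Num.Theory.
Import numFieldNormedType.Exports.
Local Open Scope classical_set_scope.
Local Open Scope ring_scope.
Local Open Scope card_scope.

Definition word (d : nat) := seq 'I_d.

Section Tree.
Variable d : nat.
Local Notation word := (word d).
(* Groups of tree automorphisms are sets of maps on vertices, with composition
   as group law. *)
Local Notation tmap := (word -> word).

Definition adjacent (v w : word) : Prop :=
  (exists x, w = rcons v x) \/ (exists x, v = rcons w x).

Definition autT : set tmap :=
  [set g : word -> word | [/\ bijective g, g [::] = [::] &
               forall v w, adjacent (g v) (g w) <-> adjacent v w]].

Definition subgroup (G : set tmap) : Prop :=
  [/\ G `<=` autT, G id,
      forall g h, G g -> G h -> G (g \o h) &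
      forall g h, G g -> cancel g h -> cancel h g -> G h].

(* Closure in autT for the topology in which the pointwise stabilizers of the
   levels form a basis of neighbourhoods of the identity. *)
Definition closureT (S : set tmap) : set tmap :=
  [set g : word -> word | autT g /\ forall n, exists2 s, S s &
             forall v : word, (size v <= n)%N -> g v = s v].

Definition closed_subgroup (G : set tmap) : Prop :=
  subgroup G /\ closureT G `<=` G.

Definition top_gen (S : set tmap) : set tmap :=
  [set g : word -> word | forall H, closed_subgroup H -> S `<=` H -> H g].

Definition normal_in (G H : set tmap) : Prop :=
  [/\ subgroup H, H `<=` G &
      forall g g' h, G g -> cancel g g' -> cancel g' g -> H h ->
                     H (g \o h \o g')].

(* Normal closure in the sense of profinite groups: the smallest closed normal
   subgroup of G containing S. *)
Definition normal_closure (G S : set tmap) : set tmap :=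
  [set g : word -> word | forall H, closed_subgroup H -> normal_in G H -> S `<=` H -> H g].

Definition finite_index (G H : set tmap) : Prop :=
  exists n, exists c : 'I_n -> tmap, (forall i, G (c i)) /\
    forall g, G g -> exists i, exists2 h, H h & g = c i \o h.

(* For an automorphism g, g (v ++ w) = g v ++ (g|_v) w with
   size (g v) = size v. *)
Definition section (g : tmap) (v : word) : tmap :=
  fun w => drop (size v) (g (v ++ w)).

Definition vproj (H : set tmap) (v : word) : set tmap :=
  [set section h v | h in [set h | H h /\ h v = v]].

Definition St (G : set tmap) (n : nat) : set tmap :=
  [set g : word -> word | G g /\ forall v : word, size v = n -> g v = v].

Definition self_similar (G : set tmap) : Prop :=
  forall g v, G g -> G (section g v).

Definition level_transitive (G : set tmap) : Prop :=
  forall v w : word, size v = size w -> exists2 g, G g & g v = w.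

Definition fractal (G : set tmap) : Prop :=
  [/\ self_similar G, level_transitive G & forall v, vproj G v = G].

Definition martingale (G : set tmap) : Prop :=
  forall (n : nat) (v : word), (0 < n)%N -> size v = n ->
  forall w w' : word, size w = size w' ->
    exists2 g, St G n g & g (v ++ w) = v ++ w'.

Definition mixing_subgroup (G : set tmap) (N : nat) (H : set tmap) : Prop :=
  [/\ subgroup H, H `<=` G, finite_index G H &
      forall (n : nat) (v : word), (0 < n)%N -> (n + N <= size v)%N ->
        H `<=` vproj (St G n) v].

Definition maximal_mixing (G : set tmap) (N : nat) : set tmap :=
  [set g : word -> word | forall (n : nat) (v : word), (0 < n)%N -> size v = (n + N)%N ->
             vproj (St G n) v g].

Definition project_invariant (H : set tmap) : Prop :=
  forall v, vproj H v `<=` H.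

(* tau identifies the tree of words with the rooted tree of iterated preimages of tau [::]
   under h, level n of T corresponding to the fibre of the n-th iterate. *)
Definition tree_iso (X : Type) (h : X -> X) (tau : word -> X) : Prop :=
  (forall v, injective (fun x => tau (rcons v x))) /\
  (forall v y, h y = tau v <-> exists x, y = tau (rcons v x)).

End Tree.

(* A rational function is given as numerator and denominator, meant to be
   coprime; P^1(F) is option F, None being the point at
   infinity. *)
Notation ratfun F := ({poly F} * {poly F})%type.
Notation P1 F := (option F).

Definition rf_map (F E : fieldType) (i : F -> E) (f : ratfun F) : ratfun E :=
  (map_poly i f.1, map_poly i f.2).

Section Ratfun.
Variable F : fieldType.
Implicit Types (f g : ratfun F) (z p : P1 F).

Definition rf_degree f : nat := (maxn (size f.1) (size f.2)).-1.

Definition rf_eval f z : P1 F :=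
  let: (a, b) := if z is Some x then (f.1.[x], f.2.[x])
                 else (f.1`_(rf_degree f), f.2`_(rf_degree f)) in
  if b == 0 then None else Some (a / b).

Definition rf_comp f g : ratfun F :=
  let D := rf_degree f in
  (\sum_(i < D.+1) f.1`_i *: (g.1 ^+ i * g.2 ^+ (D - i)),
   \sum_(i < D.+1) f.2`_i *: (g.1 ^+ i * g.2 ^+ (D - i))).

Definition rf_iter f n : ratfun F := iter n (rf_comp f) ('X, 1).

(* The local degree at z is the multiplicity of z as a zero of the binary form
   of degree rf_degree f that cuts out the fibre through z. *)
Definition fibre_poly f (w : P1 F) : {poly F} :=
  if w is Some y then f.1 - y *: f.2 else f.2.

Definition local_degree f z : nat :=
  let q := fibre_poly f (rf_eval f z) in
  if z is Some x then mup x q else (rf_degree f - (size q).-1)%N.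

Definition tamely_ramified f : Prop :=
  forall z (q : nat), q \in [pchar F] -> ~~ (q %| local_degree f z)%N.

Definition critical f : set (P1 F) := [set z | (1 < local_degree f z)%N].

Definition postcritical f : set (P1 F) :=
  \bigcup_(n in [set n | (0 < n)%N]) (iter n (rf_eval f) @` critical f).

Definition is_lcm (S : set nat) (m : nat) : Prop :=
  (forall n, S n -> (n %| m)%N) /\
  (forall m', (forall n, S n -> (n %| m')%N) -> (m %| m')%N).

Definition is_gcd (S : set nat) (m : nat) : Prop :=
  (forall n, S n -> (m %| n)%N) /\
  (forall m', (forall n, S n -> (m' %| n)%N) -> (m' %| m)%N).

(* 0 encodes the value infinity: 0 is the least common multiple, for
   divisibility, of a set of positive integers without positive common
   multiple. *)
Definition nu f z : nat :=
  xget 0%N (is_lcm [set m | exists n w,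
    [/\ (0 < n)%N, rf_eval (rf_iter f n) w = z &
        m = local_degree (rf_iter f n) w]]).

Definition pcf f : Prop := finite_set (postcritical f).

(* The inverse of 0 being 0, the points with infinite weight contribute 1. *)
Definition orb_char f : rat :=
  2%:R - \sum_(z \in postcritical f) (1 - (nu f z)%:R^-1 : rat).

Definition exceptional f : Prop := pcf f /\ orb_char f = 0.

(* The backward path gamma is coded by its start gamma(0) and the sequence
   gamma(1), ..., gamma(L). *)
Definition bpath f (x : P1 F) (s : seq (P1 F)) : bool :=
  path (fun a b => rf_eval f b == a) x s.

Definition path_energy f (s : seq (P1 F)) : nat :=
  (\prod_(z <- s) local_degree f z)%N.

Definition good_pair f p (x : P1 F) (s1 s2 : seq (P1 F)) : Prop :=
  [/\ bpath f x s1, bpath f x s2, last x s1 = p, ~ postcritical f (last x s2) &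
      (size s2 <= size s1)%N].

Definition pair_energy f (s1 s2 : seq (P1 F)) : nat :=
  (path_energy f s2 %/ gcdn (path_energy f s1) (path_energy f s2))%N.

Definition pair_energies f p : set nat :=
  [set m | exists x s1 s2, good_pair f p x s1 s2 /\ m = pair_energy f s1 s2].

Definition energy_exp f p : nat :=
  if `[< pair_energies f p !=set0 >] then xget 0%N (is_gcd (pair_energies f p))
  else 1%N.

End Ratfun.

Definition separable_closure (F E : fieldType) (i : {rmorphism F -> E}) : Prop :=
  (forall x : E, exists2 p : {poly F},
      separable_poly p & root (map_poly i p) x) /\
  (forall p : {poly E}, separable_poly p -> (1 < size p)%N ->
      exists x, root p x).

Section Galois.
(* k is the separably closed constant field, L a separable closure of k(t). *)
Variables (k L : fieldType) (lam : {rmorphism {fraction {poly k}} -> L}).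

Definition const_emb (x : k) : L := lam (tofrac x%:P).

Definition tvar : L := lam (tofrac 'X).

Definition galois_auto (sigma : {rmorphism L -> L}) : Prop :=
  bijective sigma /\ forall x, sigma (lam x) = lam x.

Definition acts_as (d : nat) (tau : word d -> P1 L) (sigma : L -> L)
    (g : word d -> word d) : Prop :=
  forall v, omap sigma (tau v) = tau (g v).

Definition Ginf (d : nat) (tau : word d -> P1 L) : set (word d -> word d) :=
  [set g : word d -> word d | autT g /\ exists2 sigma, galois_auto sigma & acts_as tau sigma g].

(* Let s be a parameter of k(t), i.e. t or 1/t. *)
Definition eval_at (s : L) (q : {poly k}) : L := (map_poly const_emb q).[s].

Definition int_closure (s : L) : set L := [set x | integralOver (eval_at s) x].

Definition prime_ideal (B P : set L) : Prop :=
  [/\ P `<=` B, P 0 /\ ~ P 1,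
      forall x y, P x -> P y -> P (x + y),
      forall b x, B b -> P x -> P (b * x) &
      forall x y, B x -> B y -> P (x * y) -> P x \/ P y].

Variables (kbar : fieldType) (kappa : {rmorphism k -> kbar}).

(* The parameter s with the value p0 that it takes at p : the prime (t - p) is
   the kernel of q |-> q(p0) on k[s]. *)
Definition parameter (p : P1 kbar) : L * kbar :=
  if p is Some a then (tvar, a) else (tvar^-1, 0).

Definition prime_above (p : P1 kbar) (P : set L) : Prop :=
  let: (s, p0) := parameter p in
  prime_ideal (int_closure s) P /\
  forall q : {poly k}, P (eval_at s q) <-> root (map_poly kappa q) p0.

Definition inertia (d : nat) (tau : word d -> P1 L) (p : P1 kbar) (P : set L) :
    set (word d -> word d) :=
  [set g : word d -> word d | autT g /\ exists sigma : {rmorphism L -> L},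
     [/\ galois_auto sigma,
         forall x, int_closure (parameter p).1 x -> P (sigma x - x) &
         acts_as tau sigma g]].

(* The set X of branch points may be infinite; the equality of the ordered
   product with 1 is then read level by level: on each level only finitely many
   g p act nontrivially, and their product in the given order is trivial
   there. *)
Definition ordered_product_one (d : nat) (X : set (P1 kbar))
    (g : P1 kbar -> word d -> word d) : Prop :=
  exists r : rel (P1 kbar),
    [/\ reflexive r, antisymmetric r, transitive r & total r] /\
    forall n, exists s : seq (P1 kbar),
      [/\ uniq s && sorted r s,
          forall p, p \in s -> X p,
          forall p, X p -> p \notin s ->
            forall v : word d, size v = n -> g p v = v &
          forall v : word d, size v = n ->
            foldr (fun p h => g p \o h) id s v = v].

Definition inertia_generators (d : nat) (tau : word d -> P1 L)
    (X : set (P1 kbar)) (g : P1 kbar -> word d -> word d) : Prop :=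
  [/\ forall p, X p -> exists2 P, prime_above p P &
        top_gen [set g p] = inertia tau p P,
      Ginf tau = top_gen (g @` X) &
      ordered_product_one X g].

End Galois.

(* A loop at the base point tau [::] avoiding the post-critical set P acts on
   the tree of preimages by sending the start of each lift to its end. *)
Definition IMG (R : realType) (X : topologicalType) (h : X -> X) (P : set X)
    (d : nat) (tau : word d -> X) : set (word d -> word d) :=
  [set g : word d -> word d | autT g /\ exists gamma : R -> X,
    [/\ {within `[0, 1], continuous gamma},
        gamma 0 = tau [::] /\ gamma 1 = tau [::],
        forall s, s \in `[0, 1] -> ~ P (gamma s) &
        forall v, exists lift : R -> X,
          [/\ {within `[0, 1], continuous lift},
              forall s, s \in `[0, 1] -> iter (size v) h (lift s) = gamma s,
              lift 0 = tau v & lift 1 = tau (g v)]]].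

Section Torus.
Variable R : realType.
Local Notation C := (R[i])^o.
Variables w1 w2 : C.

Definition lattice : set C :=
  [set z | exists m n : int, z = m%:~R * w1 + n%:~R * w2].

Definition lattice_basis : Prop :=
  forall a b : R, a%:C%C * w1 + b%:C%C * w2 = 0 -> a = 0 /\ b = 0.

Definition lattice_rel : rel C := fun x y => `[< lattice (x - y) >].

Lemma lattice_rel_equiv : equiv_class_of lattice_rel.
Proof.
split=> [x|x y|y x z].
- by apply/asboolP; exists 0, 0; rewrite subrr !mul0r addr0.
- apply/asboolP/asboolP => -[m [n e]]; exists (- m), (- n);
  by rewrite !mulrNz !mulNr -opprD -e opprB.
- move=> /asboolP[m [n e]] /asboolP[m' [n' e']]; apply/asboolP.
  exists (m + m'), (n + n').
  by rewrite !rmorphD /= !mulrDl addrACA -e -e' addrA subrK.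
Qed.

Canonical lattice_equiv := EquivRelPack lattice_rel_equiv.

Definition torus := quotient_topology {eq_quot lattice_equiv}%qT.

Definition torus_pi (z : C) : torus := \pi_(torus)%qT z.

End Torus.

(* Charts of P^1(C) at the finite points and at infinity. *)
Definition holomorphicP1 (R : realType)
    (g : (R[i])^o -> one_point_compactification (R[i])^o) : Prop :=
  continuous g /\
  forall z : (R[i])^o,
    if g z is Some _
    then derivable (fun u => odflt 0 (g u) : (R[i])^o) z 1
    else derivable (fun u => (if g u is Some w then w^-1 else 0) : (R[i])^o) z 1.

(* A presentation of f on P^1(C) as the quotient by H = <z |-> eps z> of the
   map F(z) = a z + b of the torus C / (Z w1 + Z w2), with compatible
   identifications tauf, tauF of the tree of words with the trees of preimages of base points
   x0, y0 such that proj y0 = x0.  Since F is unramified, its post-critical set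
   is empty. *)
Definition torus_model (R : realType) (f : ratfun R[i]) (d : nat)
    (G Gm : set (word d -> word d)) : Prop :=
  exists (w1 w2 a b eps : (R[i])^o) (F : torus w1 w2 -> torus w1 w2)
    (proj : torus w1 w2 -> one_point_compactification (R[i])^o)
    (tauf : word d -> one_point_compactification (R[i])^o)
    (tauF : word d -> torus w1 w2),
  let h := rf_eval f : one_point_compactification (R[i])^o ->
                       one_point_compactification (R[i])^o in
  [/\ lattice_basis w1 w2,
      (forall z, lattice w1 w2 z -> lattice w1 w2 (a * z)) /\
      (forall z, F (torus_pi w1 w2 z) = torus_pi w1 w2 (a * z + b)),
      (exists2 m, (0 < m)%N & eps ^+ m = 1) /\
      (forall z, lattice w1 w2 z -> lattice w1 w2 (eps * z)),
      [/\ holomorphicP1 (proj \o torus_pi w1 w2),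
          forall y, exists x, proj x = y,
          forall z z', proj (torus_pi w1 w2 z) = proj (torus_pi w1 w2 z') <->
            exists j, torus_pi w1 w2 z' = torus_pi w1 w2 (eps ^+ j * z) &
          forall x, proj (F x) = h (proj x)] &
      [/\ tree_iso h tauf /\ ~ postcritical f (tauf [::]),
          tree_iso F tauF /\ (forall v, proj (tauF v) = tauf v),
          G = closureT (IMG R h (postcritical f) tauf) &
          Gm = closureT (IMG R F set0 tauF)]].

(* fbar is f over the algebraic closure kbar of K. *)
Definition is_Gm (R : realType) (kbar : fieldType) (fbar : ratfun kbar)
    (d : nat) (G : set (word d -> word d)) (g : P1 kbar -> word d -> word d)
    (Gm : set (word d -> word d)) : Prop :=
  let finite_nu := forall z, (0 < nu fbar z)%N in
  (~ (exceptional fbar /\ finite_nu) ->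
     Gm = normal_closure G
            (top_gen [set iter (energy_exp fbar p) (g p)
                     | p in postcritical fbar])) /\
  (exceptional fbar /\ finite_nu ->
     exists emb : {rmorphism kbar -> R[i]},
       torus_model (rf_map emb fbar) G Gm).

(* Main.v *)
Require Import Defs.
From HB Require Import structures.
From mathcomp Require Import all_boot all_order all_algebra all_field.
From mathcomp Require Import all_classical all_reals all_analysis.
From mathcomp Require Import complex.
Import Order.TTheory GRing.Theory Num.Theory.
Import numFieldNormedType.Exports.
Local Open Scope classical_set_scope.
Local Open Scope ring_scope.
Local Open Scope card_scope.

(** The inclusion of [Gm] in the maximal mixing subgroup is the mixing property
    at the vertices of level exactly n + N.

    For the converse, [Gm] is closed: it is an intersection of closed subgroups
    in the generic case and the closure of an iterated monodromy group in the
    exceptional one ([is_Gm_closed]).  A closed subgroup of finite index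
    is open, so [Gm] contains St_G(n) for some n >= 1 ([closed_finite_index_open]).
    For any vertex v of level n + N, the maximal mixing subgroup is contained
    in St_G(n)_v, hence in (Gm)_v, hence in [Gm] by project invariance
    ([project_invariant_maximal_mixing]). *)

Section TreeAutomorphisms.
Set Implicit Arguments.
Variable d : nat.
Implicit Types (g h : word d -> word d) (u v w : word d) (x : 'I_d).
Implicit Types (G H S : set (word d -> word d)).

(** A child can only be sent next to the image of its parent, and the place of
    the grandparent above that image is already taken; so children go to
    children. *)
Lemma autT_rcons g u x : autT g -> exists y, g (rcons u x) = rcons (g u) y.
Proof.
move=> [/bij_inj ginj groot gadj].
have adj_child v y : Defs.adjacent (g v) (g (rcons v y)).
  by apply/gadj; left; exists y.
elim/last_ind: u x => [|u z IH] x.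
  case: (adj_child [::] x) => -[y e]; first by exists y.
  by move: e; rewrite groot => /(congr1 size); rewrite size_rcons.
case: (adj_child (rcons u z) x) => -[y e]; first by exists y.
have [y' e'] := IH z.
have /ginj/(congr1 size) : g u = g (rcons (rcons u z) x).
  by move: e; rewrite e' => /rcons_inj[].
by rewrite !size_rcons => /eqP; rewrite -[X in X == _]addn0 -addn2 eqn_add2l.
Qed.

Lemma size_autT g v : autT g -> size (g v) = size v.
Proof.
move=> gA; elim/last_ind: v => [|v x IH]; first by case: gA => _ ->.
by have [y ->] := autT_rcons v x gA; rewrite !size_rcons IH.
Qed.

(** An alphabet with a letter lets every shorter word be extended to level n,
    and automorphisms respect prefixes. *)
Lemma autT_fix_below g n : (0 < d)%N -> autT g ->
  (forall v, size v = n -> g v = v) -> forall v, (size v <= n)%N -> g v = v.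
Proof.
move=> d_gt0 gA gfix v /subnK; move: (n - size v)%N => k.
elim: k v => [|k IH] v e; first exact: gfix.
have x : 'I_d by exact: Ordinal d_gt0.
have gvx : g (rcons v x) = rcons v x by apply: IH; rewrite size_rcons addnS -e.
by have [y] := autT_rcons v x gA; rewrite gvx => /rcons_inj[].
Qed.

Lemma closureT_mono S S' : S `<=` S' -> Defs.closureT S `<=` Defs.closureT S'.
Proof.
move=> SS' g [gA gS]; split=> // n.
by have [s /SS' ? gs] := gS n; exists s.
Qed.

Lemma closureT_idem S : Defs.closureT (Defs.closureT S) `<=` Defs.closureT S.
Proof.
move=> g [gA gS]; split=> // n.
have [s [_ /(_ n)[r Sr sr]] gs] := gS n.
by exists r => // v nv; rewrite gs // sr.
Qed.

Lemma normal_closure_closed G S :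
  Defs.closureT (normal_closure G S) `<=` normal_closure G S.
Proof.
move=> g clg H Hcl Hn SH; case: (Hcl) => _; apply.
by apply: closureT_mono clg => s; apply.
Qed.

(** The complement of a closed subgroup of finite index is a finite union of
    closed cosets, so the subgroup is open.  Concretely, a level n at which
    every coset representative outside [H] is told apart from all of [H] will
    do: if g = c h fixes level n, then c agrees with the inverse of h on the
    first n levels. *)
Lemma closed_finite_index_open G H : (0 < d)%N ->
  G `<=` @autT d -> subgroup H -> Defs.closureT H `<=` H -> finite_index G H ->
  exists2 n, (0 < n)%N & St G n `<=` H.
Proof.
move=> d_gt0 GA [HA _ Hmul Hinv] Hcl [m [c [Gc Gcover]]].
have sep i : exists n, H (c i) \/
    ~ exists2 s, H s & forall v, (size v <= n)%N -> c i v = s v.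
  have [Hci|nHci] := pselect (H (c i)); first by exists 0%N; left.
  apply: contrapT => nsep; apply/nHci/Hcl; split=> [|n]; first exact/GA/Gc.
  by apply: contrapT => ns; apply: nsep; exists n; right.
have [n_ n_sep] := choice sep.
exists (\max_i n_ i).+1 => // g [Gg gfix].
have [i [h Hh eg]] := Gcover g Gg.
case: (n_sep i) => [Hci|[]]; first by rewrite eg; apply: Hmul.
have hA := HA h Hh.
have [[h' hK h'K] _ _] := hA.
have Hh' : H h' by exact: Hinv Hh hK h'K.
exists h' => // v nv.
have gh'v : g (h' v) = h' v.
  apply: (autT_fix_below d_gt0 (GA _ Gg) gfix).
  rewrite (size_autT v (HA _ Hh')); apply: leq_trans nv _.
  exact: leqW (leq_bigmax i).
by rewrite -[RHS]gh'v eg /= h'K.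
Qed.

Lemma project_invariant_maximal_mixing G H n N : (0 < d)%N -> (0 < n)%N ->
  St G n `<=` H -> project_invariant H -> maximal_mixing G N `<=` H.
Proof.
move=> d_gt0 n_gt0 StH Hpi g.
pose v : word d := nseq (n + N) (Ordinal d_gt0).
move=> /(_ n v n_gt0 (size_nseq _ _))[h [Sth hv] <-].
by apply: (Hpi v); exists h => //; split=> //; apply: StH.
Qed.

End TreeAutomorphisms.

Lemma is_Gm_closed (R : realType) (kbar : fieldType) (fbar : ratfun kbar)
    (d : nat) (G : set (word d -> word d)) (g : P1 kbar -> word d -> word d)
    (Gm : set (word d -> word d)) :
  is_Gm R fbar G g Gm -> Defs.closureT Gm `<=` Gm.
Proof.
move=> [Gm_gen Gm_torus].
have [exc|nexc] := pselect (exceptional fbar /\ forall z, (0 < nu fbar z)%N).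
  have [emb [w1 [w2 [a [b [eps [F [proj [tauf [tauF]]]]]]]]]] := Gm_torus exc.
  by case=> _ _ _ _ [_ _ _ ->]; apply: closureT_idem.
by rewrite Gm_gen //; apply: normal_closure_closed.
Qed.

Theorem theorem5
  (R : realType)
  (* the field K, its separable closure k, an algebraic closure kbar, and a
     separable closure L of k(t) *)
  (K k L : fieldType) (kbar : closedFieldType)
  (iota : {rmorphism K -> k}) (kappa : {rmorphism k -> kbar})
  (lam : {rmorphism {fraction {poly k}} -> L})
  (k_sep : separable_closure iota)
  (kbar_alg : integralRange (kappa \o iota))
  (L_sep : separable_closure lam)
  (* the rational function f, over K, kbar and L *)
  (f : ratfun K) (d : nat)
  (f_coprime : coprimep f.1 f.2)
  (f_deg : rf_degree f = d) (d_ge2 : (2 <= d)%N) :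
  let fbar := rf_map (kappa \o iota) f in
  let fL := rf_map (const_emb lam \o iota) f in
  forall (f_tame : tamely_ramified fbar)
  (* the fixed identification of the tree of preimages of t with T *)
  (tau : word d -> P1 L)
  (tau_root : tau [::] = Some (tvar lam))
  (tau_iso : tree_iso (rf_eval fL) tau),
  let G := Ginf lam tau in
  forall (G_fractal : fractal G)
  (G_martingale : martingale G)
  (f_exc : exceptional fbar ->
     [pchar K] =i pred0 /\ [set: K] #<= [set: nat -> bool])
  (* the inertia generators *)
  (g : P1 kbar -> word d -> word d)
  (g_gen : inertia_generators lam kappa tau (postcritical fbar) g)
  (Gm : set (word d -> word d))
  (Gm_def : is_Gm R fbar G g Gm)
  (N : nat)
  (Gm_mixing : mixing_subgroup G N Gm)
  (Gm_proj_inv : project_invariant Gm),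
  Gm = maximal_mixing G N.
Proof.
move=> fbar fL _ tau _ _ G _ _ _ g _ Gm Gm_def N Gm_mixing Gm_proj_inv.
have d_gt0 : (0 < d)%N by exact: ltnW.
have [Gm_sub GmG Gm_fin mix] := Gm_mixing.
have Gm_cl := is_Gm_closed Gm_def.
rewrite eqEsubset; split=> [h Gmh n v n_gt0 vn|].
  by apply: (mix n v) => //; rewrite vn.
have [n n_gt0 StGm] : exists2 n, (0 < n)%N & St G n `<=` Gm.
  by apply: closed_finite_index_open => // h [].
exact: project_invariant_maximal_mixing n_gt0 StGm Gm_proj_inv.
Qed.
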